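(* Let $n\ge 1$, let $(M,\phi,\xi,\eta,g)$ be a $(2n+1)$-dimensional $(\alpha,\beta)$-contact metric manifold satisfying $\nabla\operatorname{Ric}=0$, and let $\lambda$ be a smooth function on $M$. (1) If $(\xi,\lambda)$ defines an almost Riemann soliton on $M$, then $d\lambda=d\alpha$. (2) If $(\xi,\lambda)$ defines an almost Ricci soliton on $M$, then $\lambda$ is a constant.
   Context: Manifolds are smooth and connected. An almost contact metric manifold $(M,\phi,\xi,\eta,g)$ of dimension $2n+1$ is a smooth manifold $M$ with a $(1,1)$-tensor field $\phi$, a vector field $\xi$, a $1$-form $\eta$ and a Riemannian metric $g$ such that $\phi^2=-(\mathrm{Id}-\eta\otimes\xi)$, $\eta(\xi)=1$, $\phi\xi=0$, $\eta\circ\phi=0$, $i_\xi g=\eta$, $g(\phi X,\phi Y)=g(X,Y)-\eta(X)\eta(Y)$ and $g(\phi X,Y)=-g(X,\phi Y)$ for all vector fields $X,Y$. It is an $(\alpha,\beta)$-contact metric manifold (trans-Sasakian manifold) if there are smooth functions $\alpha,\beta$ on $M$ such that the Levi-Civita connection $\nabla$ of $g$ satisfies $$(\nabla_X\phi)Y=\alpha[g(\phi X,Y)\xi-\eta(Y)\phi X]+\beta[g(X,Y)\xi-\eta(Y)X]$$ for all vector fields $X,Y$. Conventions: $R(X,Y,Z,W)=g(R(X,Y)Z,W)$ with $R(X,Y)Z=\nabla_X\nabla_YZ-\nabla_Y\nabla_XZ-\nabla_{[X,Y]}Z$; $\operatorname{Ric}(Y,Z)=\sum_i R(E_i,Y,Z,E_i)$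 for an orthonormal frame $\{E_i\}$. The Kulkarni–Nomizu product of two $(0,2)$-tensor fields is $$(T_1\odot T_2)(X,Y,Z,W)=T_1(X,W)T_2(Y,Z)+T_1(Y,Z)T_2(X,W)-T_1(X,Z)T_2(Y,W)-T_1(Y,W)T_2(X,Z).$$ For a vector field $V$ and a smooth function $\lambda$, with $\pounds_V$ the Lie derivative: $(V,\lambda)$ defines an almost Riemann soliton if $\frac12\pounds_Vg\odot g+R=\lambda G$, where $G=\frac12 g\odot g$; it defines an almost Ricci soliton if $\frac12\pounds_Vg+\operatorname{Ric}=\lambda g$. *)

(* Defs.v *)
From mathcomp Require Import all_boot all_order all_algebra.
From mathcomp Require Import all_classical all_reals all_analysis.

Set Implicit Arguments.
Unset Strict Implicit.
Unset Printing Implicit Defensive.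

Import Order.TTheory GRing.Theory Num.Theory.
Import numFieldNormedType.Exports.

Local Open Scope classical_set_scope.
Local Open Scope ring_scope.

(* [Ck k U f]: f is k times Frechet differentiable with continuous derivatives
   on U.  Only used with U open, where it does not depend on f outside U. *)
Fixpoint Ck (R : realType) (V W : normedModType R) (k : nat)
    (U : set V) (f : V -> W) : Prop :=
  match k with
  | 0 => forall x, U x -> {for x, continuous f}
  | k'.+1 => (forall x, U x -> differentiable f x) /\
             (forall v : V, Ck k' U (fun x => 'D_v f x))
  end.

Definition smooth (R : realType) (V W : normedModType R)
    (U : set V) (f : V -> W) : Prop := forall k, Ck k U f.

(* [coord] and [param] are total functions; only [coord] on [dom] and its
   inverse [param] on [coord @` dom] are meaningful. *)
Record chart (R : realType) (d : nat) (M : topologicalType) := Chart {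
  dom : set M;
  coord : M -> 'rV[R]_d;
  param : 'rV[R]_d -> M;
  dom_open : open dom;
  img_open : open (coord @` dom);
  coordK : forall p, dom p -> param (coord p) = p;
  coord_continuous : {within dom, continuous coord};
  param_continuous : {within coord @` dom, continuous param}
}.

Record smoothManifold (R : realType) (d : nat) := SmoothManifold {
  carrier :> topologicalType;
  atlas : set (chart R d carrier);
  chart_at : carrier -> chart R d carrier;
  chart_at_atlas : forall p, atlas (chart_at p);
  chart_at_dom : forall p, dom (chart_at p) p;
  transition_smooth : forall c c', atlas c -> atlas c' ->
    smooth (coord c @` (dom c `&` dom c')) (coord c' \o param c);
  manifold_hausdorff : hausdorff_space carrier;
  manifold_second_countable : @second_countable carrier;
  manifold_connected : connected [set: carrier]
}.

Section Calculus.
Variables (R : realType) (d : nat) (M : smoothManifold R d).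

(* A vector v : 'rV[R]_d is the tangent vector at p whose components are v in
   the preferred chart [chart_at M p]; this identifies T_pM with R^d for each p
   separately.  [comp c p v] gives the components of the same tangent vector in
   another chart c around p. *)
Definition tangent (p : M) : normedModType R := 'rV[R]_d.

Definition comp (c : chart R d M) (p : M) (v : tangent p) : 'rV[R]_d :=
  'D_v (coord c \o param (chart_at p)) (coord (chart_at p) p).
Arguments comp c p v : clear implicits.

Definition vfield := forall p : M, tangent p.

(* [differential f p v] is df_p(v). *)
Definition differential (f : M -> R) (p : M) (v : tangent p) : R :=
  'D_v (f \o param (chart_at p)) (coord (chart_at p) p).
Arguments differential f p v : clear implicits.

Definition act (X : vfield) (f : M -> R) : M -> R :=
  fun p => differential f p (X p).

(* Functions and fields are total, but regularity is required on open sets U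
   only: [smooth_fun U] and [smooth_vfield U] stand for the functions and the
   vector fields of the open submanifold U. *)
Definition smooth_fun (U : set M) (f : M -> R) : Prop :=
  forall c, atlas c -> smooth (coord c @` (U `&` dom c)) (f \o param c).

Definition local_rep (c : chart R d M) (X : vfield) (x : 'rV[R]_d) : 'rV[R]_d :=
  comp c (param c x) (X (param c x)).

Definition smooth_vfield (U : set M) (X : vfield) : Prop :=
  forall c, atlas c -> smooth (coord c @` (U `&` dom c)) (local_rep c X).

(* [X, Y]^k = X(Y^k) - Y(X^k), computed at p in the preferred chart at p. *)
Definition bracket (X Y : vfield) : vfield := fun p =>
  let c := chart_at p in
  'D_(X p) (local_rep c Y) (coord c p) - 'D_(Y p) (local_rep c X) (coord c p).

(* Tensor fields are given pointwise; smoothness is tested on smooth fields. *)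
Definition tensor02 := forall p : M, tangent p -> tangent p -> R.

Definition on_fields (T : tensor02) (X Y : vfield) : M -> R :=
  fun p => T p (X p) (Y p).

Record riemannian_metric (g : tensor02) : Prop := {
  metric_linear : forall p (a : R) (u v w : tangent p),
    g p (a *: u + v) w = a * g p u w + g p v w;
  metric_sym : forall p (u v : tangent p), g p u v = g p v u;
  metric_pos : forall p (u : tangent p), u != 0 -> 0 < g p u u;
  metric_smooth : forall U X Y, open U ->
    smooth_vfield U X -> smooth_vfield U Y -> smooth_fun U (on_fields g X Y)
}.

Definition endo_field (phi : forall p : M, tangent p -> tangent p) : Prop :=
  (forall p (a : R) (u v : tangent p),
     phi p (a *: u + v) = a *: phi p u + phi p v) /\
  (forall U X, open U -> smooth_vfield U X ->
     smooth_vfield U (fun p => phi p (X p))).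

Definition one_form (eta : forall p : M, tangent p -> R) : Prop :=
  (forall p (a : R) (u v : tangent p),
     eta p (a *: u + v) = a * eta p u + eta p v) /\
  (forall U X, open U -> smooth_vfield U X ->
     smooth_fun U (fun p => eta p (X p))).

(* The axioms are imposed over every open U, i.e. [nabla] is a connection
   together with its restrictions to open submanifolds. *)
Record connection (nabla : vfield -> vfield -> vfield) : Prop := {
  connection_smooth : forall U X Y, open U ->
    smooth_vfield U X -> smooth_vfield U Y -> smooth_vfield U (nabla X Y);
  connection_linear : forall U f X X' Y, open U -> smooth_fun U f ->
    smooth_vfield U X -> smooth_vfield U X' -> smooth_vfield U Y ->
    forall p, U p ->
    nabla (fun q => f q *: X q + X' q) Y p = f p *: nabla X Y p + nabla X' Y p;
  connection_additive : forall U X Y Y', open U ->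
    smooth_vfield U X -> smooth_vfield U Y -> smooth_vfield U Y' ->
    forall p, U p ->
    nabla X (fun q => Y q + Y' q) p = nabla X Y p + nabla X Y' p;
  connection_leibniz : forall U f X Y, open U -> smooth_fun U f ->
    smooth_vfield U X -> smooth_vfield U Y -> forall p, U p ->
    nabla X (fun q => f q *: Y q) p = act X f p *: Y p + f p *: nabla X Y p
}.

Record levi_civita (g : tensor02) (nabla : vfield -> vfield -> vfield)
    : Prop := {
  levi_civita_connection : connection nabla;
  torsion_free : forall U X Y, open U ->
    smooth_vfield U X -> smooth_vfield U Y -> forall p, U p ->
    nabla X Y p - nabla Y X p = bracket X Y p;
  metric_compatible : forall U X Y Z, open U ->
    smooth_vfield U X -> smooth_vfield U Y -> smooth_vfield U Z ->
    forall p, U p ->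
    act X (on_fields g Y Z) p =
    g p (nabla X Y p) (Z p) + g p (Y p) (nabla X Z p)
}.

Definition curvature (nabla : vfield -> vfield -> vfield) (X Y Z : vfield)
    : vfield := fun p =>
  nabla X (nabla Y Z) p - nabla Y (nabla X Z) p - nabla (bracket X Y) Z p.

Definition riemann (g : tensor02) (nabla : vfield -> vfield -> vfield)
    (X Y Z W : vfield) : M -> R :=
  fun p => g p (curvature nabla X Y Z p) (W p).

(* Curvature being tensorial, only orthonormality of the E_i at p matters. *)
Definition ricci_tensor (g : tensor02) (nabla : vfield -> vfield -> vfield)
    (Ric : tensor02) : Prop :=
  forall U (E : 'I_d -> vfield) (Y Z : vfield) (p : M), open U -> U p ->
    (forall i, smooth_vfield U (E i)) ->
    (forall i j, g p (E i p) (E j p) = (i == j)%:R) ->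
    smooth_vfield U Y -> smooth_vfield U Z ->
    Ric p (Y p) (Z p) = \sum_(i < d) riemann g nabla (E i) Y Z (E i) p.

Definition parallel02 (nabla : vfield -> vfield -> vfield) (T : tensor02)
    : Prop :=
  forall U X Y Z, open U ->
    smooth_vfield U X -> smooth_vfield U Y -> smooth_vfield U Z ->
    forall p, U p ->
    act X (on_fields T Y Z) p
      - T p (nabla X Y p) (Z p) - T p (Y p) (nabla X Z p) = 0.

Definition lie_tensor02 (V : vfield) (T : tensor02) (X Y : vfield) : M -> R :=
  fun p => act V (on_fields T X Y) p
           - T p (bracket V X p) (Y p) - T p (X p) (bracket V Y p).

Definition kulkarni_nomizu (T1 T2 : vfield -> vfield -> M -> R)
    (X Y Z W : vfield) : M -> R := fun p =>
  T1 X W p * T2 Y Z p + T1 Y Z p * T2 X W p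
  - T1 X Z p * T2 Y W p - T1 Y W p * T2 X Z p.

Definition half_lie (V : vfield) (g : tensor02) (X Y : vfield) : M -> R :=
  fun p => 2^-1 * lie_tensor02 V g X Y p.

Definition almost_riemann_soliton (g : tensor02)
    (nabla : vfield -> vfield -> vfield) (V : vfield) (lambda : M -> R)
    : Prop :=
  forall U X Y Z W, open U ->
    smooth_vfield U X -> smooth_vfield U Y ->
    smooth_vfield U Z -> smooth_vfield U W ->
    forall p, U p ->
    kulkarni_nomizu (half_lie V g) (on_fields g) X Y Z W p
      + riemann g nabla X Y Z W p =
    lambda p *
      (2^-1 * kulkarni_nomizu (on_fields g) (on_fields g) X Y Z W p).

Definition almost_ricci_soliton (g Ric : tensor02) (V : vfield)
    (lambda : M -> R) : Prop :=
  forall U X Y, open U -> smooth_vfield U X -> smooth_vfield U Y ->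
    forall p, U p ->
    half_lie V g X Y p + Ric p (X p) (Y p) = lambda p * g p (X p) (Y p).

Record almost_contact_metric (phi : forall p : M, tangent p -> tangent p)
    (xi : vfield) (eta : forall p : M, tangent p -> R) (g : tensor02)
    : Prop := {
  acm_phi : endo_field phi;
  acm_xi : smooth_vfield [set: M] xi;
  acm_eta : one_form eta;
  acm_g : riemannian_metric g;
  acm_phi_sq : forall p (u : tangent p),
    phi p (phi p u) = - (u - eta p u *: xi p);
  acm_eta_xi : forall p, eta p (xi p) = 1;
  acm_phi_xi : forall p, phi p (xi p) = 0;
  acm_eta_phi : forall p (u : tangent p), eta p (phi p u) = 0;
  acm_xi_dual : forall p (u : tangent p), g p (xi p) u = eta p u;
  acm_isometry : forall p (u v : tangent p),
    g p (phi p u) (phi p v) = g p u v - eta p u * eta p v;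
  acm_skew : forall p (u v : tangent p), g p (phi p u) v = - g p u (phi p v)
}.

(* The left-hand side is (nabla_X phi) Y. *)
Definition alpha_beta_contact (phi : forall p : M, tangent p -> tangent p)
    (xi : vfield) (eta : forall p : M, tangent p -> R) (g : tensor02)
    (nabla : vfield -> vfield -> vfield) (alpha beta : M -> R) : Prop :=
  forall U X Y, open U -> smooth_vfield U X -> smooth_vfield U Y ->
    forall p, U p ->
    nabla X (fun q => phi q (Y q)) p - phi p (nabla X Y p) =
    alpha p *: (g p (phi p (X p)) (Y p) *: xi p - eta p (Y p) *: phi p (X p))
    + beta p *: (g p (X p) (Y p) *: xi p - eta p (Y p) *: X p).

End Calculus.

Arguments comp {R d M} c p v.
Arguments differential {R d M} f p v.

(* Main.v *)
Require Import Defs.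
From HB Require Import structures.
From mathcomp Require Import all_boot all_order all_algebra.
From mathcomp Require Import all_classical all_reals all_analysis.
From mathcomp Require Import ring.

Set Implicit Arguments.
Unset Strict Implicit.
Unset Printing Implicit Defensive.

Import Order.TTheory GRing.Theory Num.Theory.
Import numFieldNormedType.Exports.

Local Open Scope classical_set_scope.
Local Open Scope ring_scope.

(** The Reeb field [xi] is an eigenvector of the Ricci tensor, with an
    eigenvalue [f] that the soliton equation determines, and parallelism of Ric
    forces [f] to be constant.

    Applying [phi] to the structure equation with [Y = xi], and using that [xi]
    has unit length, gives
      nabla_X xi = alpha (X - eta(X) xi) - beta phi X      [nabla_xi].
    The [beta] part is skew, so it drops out of the Lie derivative:
      1/2 (L_xi g)(X, Y) = alpha (g(X, Y) - eta(X) eta(Y)) [half_lie_xi],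
    which vanishes as soon as one argument is [xi].  Hence

    - for a Ricci soliton, Ric(w, xi) = lambda eta(w);
    - for a Riemann soliton, evaluating the soliton equation on
      (E_i, w, xi, E_i) in an orthonormal frame with E_0 = xi and summing over
      i gives Ric(w, xi) = 2n (lambda - alpha) eta(w), the term i = 0
      contributing nothing.

    In both cases Ric(w, xi) = Ric(xi, w) = f eta(w), so Ric(xi, xi) = f, and
      X(f) = X(Ric(xi, xi)) = Ric(nabla_X xi, xi) + Ric(xi, nabla_X xi)
           = 2 f eta(nabla_X xi) = 0
    because [nabla_X xi] is orthogonal to the unit field [xi]
    [parallel_ricci_eigenvalue].  For Riemann solitons this says
    d(lambda - alpha) = 0, as n > 0; for Ricci solitons d lambda = 0, and
    lambda is constant because M is connected [differential0_constant].

    All the hypotheses speak of smooth vector fields, whereas the argument above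
    is pointwise.  The passage from one to the other is [const_field]: every
    tangent vector at a point is the value of a field with constant components
    in a chart.  In another chart such a field reads as the derivative of one
    transition map composed with the inverse transition map, so its smoothness
    rests on the stability of C^k maps under composition [Ck_comp]. *)

(** * Calculus of C^k maps *)

Section CkCalculus.
Variable R : realType.
Implicit Types V W : normedModType R.

(** Scaling is a continuous bilinear map, and the product is its composite
    with the pair of factors. *)
Lemma is_diff_scale_fun V W (a da : V -> R) (f df : V -> W) (x : V) :
  is_diff x a da -> is_diff x f df ->
  is_diff x (fun y => a y *: f y) (fun v => a x *: df v + da v *: f x).
Proof.
have bil : bilinear_for (GRing.Scale.Law.clone _ _ *:%R _)
    (GRing.Scale.Law.clone _ _ *:%R _) (fun (k : R) (w : W) => k *: w).
  by split=> [u k v w|u k v w] /=; rewrite ?scalerDl ?scalerDr ?scalerA// mulrC.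
pose bM :=
  bilinear_isBilinear.Build R R W W _ _ (fun (k : R) (w : W) => k *: w) bil.
pose b : {bilinear R -> W -> W} := HB.pack (fun (k : R) (w : W) => k *: w) bM.
have cb : continuous (fun p : R * W => b p.1 p.2) by exact: scale_continuous.
move=> dax dfx.
pose h y := (a y, f y).
have dh : is_diff x h (fun v => (da v, df v)) by exact: is_diff_pair.
have db : is_diff (h x) (fun p : R * W => b p.1 p.2)
   (fun q => b (h x).1 q.2 + b q.1 (h x).2).
  by apply: DiffDef; [exact: differentiable_bilin | exact: diff_bilin].
exact: (is_diff_comp dh db).
Qed.

Lemma Ck_sub V W k (A B : set V) (f : V -> W) :
  A `<=` B -> Ck k B f -> Ck k A f.
Proof.
move=> AB; elim: k f => /= [f Bf x /AB|k IH f [Bf Bdf]]; first exact: Bf.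
by split=> [x /AB/Bf //|v]; exact/IH/Bdf.
Qed.

(** The germ at a point decides differentiability; this is what makes the
    predicate [Ck] on an open set independent of the values outside it. *)
Lemma near_eq_differentiable V W (f h : V -> W) (x : V) :
  {near x, f =1 h} -> differentiable f x -> differentiable h x.
Proof.
move=> fh df.
(* Differentiability of a map with zero germ is checked from the definition. *)
suff dk : differentiable (h - f) x.
  by rewrite -[h](subrK f); exact: differentiableD.
pose z := 'd (cst 0 : V -> W) x.
have z0 v : z v = 0 by rewrite /z diff_cst.
have cz : continuous z by apply: diff_continuous; exact: differentiable_cst.
have kz : (h - f) \o shift x = cst ((h - f) x) + z +o_ 0 id.
  apply/eqaddoP => _/posnumP[e]; near=> y.
  have hx : h x = f x by rewrite (nbhs_singleton fh).
  have hyx : h (y + x) = f (y + x).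
    suff: f (y + x) = h (y + x) by [].
    near: y; move: fh; rewrite (near_shift 0 x) /=.
    by apply: filterS => y /=; rewrite subr0.
  by rewrite /= -[X in `|X|]/(h (y + x) - f (y + x) - (h x - f x + z y))
    hx hyx !subrr z0 addr0 subrr normr0 mulr_ge0.
by apply/diff_locallyP; rewrite (diff_unique cz kz).
Unshelve. all: by end_near. Qed.

Lemma Ck_ext V W k (A : set V) (f h : V -> W) :
  open A -> (forall x, A x -> f x = h x) -> Ck k A f -> Ck k A h.
Proof.
move=> oA; elim: k f h => /= [f h fh Af x Ax|k IH f h fh [Af Adf]].
  have near_fh : {near x, f =1 h}.
    by near=> y; apply: fh; near: y; exact: open_nbhs_nbhs.
  rewrite /prop_for /continuous_at -(fh _ Ax).
  exact: cvg_trans (near_eq_cvg near_fh) (Af x Ax).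
have near_fh x : A x -> {near x, f =1 h}.
  by move=> Ax; near=> y; apply: fh; near: y; exact: open_nbhs_nbhs.
split=> [x Ax|v].
  exact: near_eq_differentiable (near_fh x Ax) (Af x Ax).
apply: (IH (fun x => 'D_v f x)) => // x Ax.
exact/near_eq_derive/near_fh.
Unshelve. all: by end_near. Qed.

Lemma Ck_continuous V W k (A : set V) (f : V -> W) :
  Ck k A f -> forall x, A x -> {for x, continuous f}.
Proof. by case: k => [//|k] [Af _] x /Af /differentiable_continuous. Qed.

Lemma CkW V W k (A : set V) (f : V -> W) : Ck k.+1 A f -> Ck k A f.
Proof.
elim: k f => [f|k IH f [Af Adf]]; first exact: (@Ck_continuous _ _ 1).
by split=> // v; exact/IH/Adf.
Qed.

Lemma Ck_linear V W (Z : normedModType R) k (A : set V) (f : V -> W)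
    (L : {linear W -> Z}) :
  open A -> continuous L -> Ck k A f -> Ck k A (L \o f).
Proof.
move=> oA cL; have dL w : differentiable L w by exact: linear_differentiable.
elim: k f => /= [f Af x Ax|k IH f [Af Adf]].
  by apply: continuous_comp; [exact: Af | exact: cL].
split=> [x Ax|v]; first exact: differentiable_comp (Af x Ax) (dL _).
apply: (@Ck_ext _ _ _ _ (L \o (fun x => 'D_v f x))) => // [x Ax|];
  last exact/IH/Adf.
have dfx := Af x Ax; have dLf := differentiable_comp dfx (dL _).
rewrite /=.
by rewrite (deriveE _ dfx) (deriveE _ dLf) (diff_comp dfx (dL _)) /= diff_lin.
Qed.

Lemma Ck_cst V W k (A : set V) (w : W) : Ck k A (cst w).
Proof.
elim: k w => /= [w x _|k IH w]; first exact: cst_continuous.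
split=> [x _|v]; first exact: differentiable_cst.
by rewrite (_ : (fun x => _) = cst 0) //; apply/funext => x; rewrite derive_cst.
Qed.

Lemma CkD V W k (A : set V) (f h : V -> W) : open A ->
  Ck k A f -> Ck k A h -> Ck k A (fun x => f x + h x).
Proof.
move=> oA; elim: k f h => /= [f h Af Ah x Ax|k IH f h [Af Adf] [Ah Adh]].
  exact: cvgD (Af x Ax) (Ah x Ax).
split=> [x Ax|v]; first exact: differentiableD (Af x Ax) (Ah x Ax).
apply: (@Ck_ext _ _ _ _ (fun x => 'D_v f x + 'D_v h x)) => // [x Ax|].
  by rewrite -deriveD//; apply: diff_derivable; [exact: Af | exact: Ah].
by apply: IH; [exact: Adf | exact: Adh].
Qed.

Lemma Ck_sum V W k (A : set V) (I : Type) (r : seq I) (f : I -> V -> W) :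
  open A -> (forall i, Ck k A (f i)) -> Ck k A (fun x => \sum_(i <- r) f i x).
Proof.
move=> oA Af; elim: r => [|i r IH].
  rewrite (_ : (fun x => _) = cst 0); first exact: Ck_cst.
  by apply/funext => x; rewrite big_nil.
rewrite (_ : (fun x => _) = fun x => f i x + \sum_(i <- r) f i x).
  exact: CkD.
by apply/funext => x; rewrite big_cons.
Qed.

Lemma CkZ V W k (A : set V) (a : V -> R) (f : V -> W) : open A ->
  Ck k A a -> Ck k A f -> Ck k A (fun x => a x *: f x).
Proof.
move=> oA; elim: k a f => /= [a f Aa Af x Ax|k IH a f Ca Cf].
  exact: cvgZ (Aa x Ax) (Af x Ax).
have [[Aa Ada] [Af Adf]] := (Ca, Cf).
have prod_diff x : A x -> is_diff x (fun y => a y *: f y)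
    (fun v => a x *: 'd f x v + 'd a x v *: f x).
  move=> Ax; apply: is_diff_scale_fun; apply: differentiableP.
    exact: Aa.
  exact: Af.
split=> [x Ax|v]; first by have [] := prod_diff x Ax.
apply: (@Ck_ext _ _ _ _ (fun x => a x *: 'D_v f x + 'D_v a x *: f x)) => //.
  move=> x Ax; have [dp pE] := prod_diff x Ax.
  rewrite (deriveE _ dp) pE.
rewrite (deriveE _ (Aa x Ax)).
by rewrite (deriveE _ (Af x Ax)).
have Wa := CkW Ca; have Wf := CkW Cf.
by apply: CkD => //; apply: IH => //.
Qed.

Lemma Ck_coord V m n k (A : set V) (f : V -> 'M[R]_(m, n)) i j : open A ->
  Ck k A f -> Ck k A (fun x => f x i j).
Proof.
move=> oA Af.
have lin : linear (fun N : 'M[R]_(m, n) => N i j : R).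
  by move=> a M N; rewrite !mxE.
pose LM := GRing.isLinear.Build _ _ _ _ _ lin.
pose L : {linear 'M[R]_(m, n) -> R} :=
  HB.pack (fun N : 'M[R]_(m, n) => N i j : R) LM.
exact: (Ck_linear (L := L) oA (@coord_continuous _ _ _ i j) Af).
Qed.

Lemma derive_comp_rV V W n (g : V -> 'rV[R]_n) (f : 'rV[R]_n -> W) (x v : V) :
  differentiable g x -> differentiable f (g x) ->
  'D_v (f \o g) x = \sum_j ('D_v g x) 0 j *: 'D_(delta_mx 0 j) f (g x).
Proof.
move=> dg df; have dfg := differentiable_comp dg df.
rewrite (deriveE _ dg) (deriveE _ dfg) (diff_comp dg df) /=.
rewrite {1}[X in _ X = _](row_sum_delta ('d g x v)) linear_sum.
by apply: eq_bigr => j _; rewrite linearZ (deriveE _ df).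
Qed.

(** By induction on [k], the chain rule [derive_comp_rV] expressing each
    directional derivative of the composite as a finite sum of products of maps
    of class C^(k-1).  The inner map takes its values in coordinate space
    because only derivatives in fixed directions are known to be of class
    C^(k-1), and finitely many of them must generate all the others. *)
Lemma Ck_comp V W n k (A : set V) (B : set 'rV[R]_n) (g : V -> 'rV[R]_n)
    (f : 'rV[R]_n -> W) : open A -> (forall x, A x -> B (g x)) ->
  Ck k A g -> Ck k B f -> Ck k A (f \o g).
Proof.
move=> oA AB; elim: k f => [f Ag Bf x Ax|k IH f Cg Cf].
  by apply: continuous_comp; [exact: Ag | exact/Bf/AB].
have [[Ag Adg] [Bf Bdf]] := (Cg, Cf).
split=> [x Ax|v]; first exact: differentiable_comp (Ag x Ax) (Bf _ (AB _ Ax)).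
apply: (@Ck_ext _ _ _ _ (fun x =>
  \sum_j ('D_v g x) 0 j *: 'D_(delta_mx 0 j) f (g x))) => // [x Ax|].
  by rewrite derive_comp_rV//; [exact: Ag | exact/Bf/AB].
apply: Ck_sum => // j; apply: CkZ => //.
  exact/Ck_coord/Adg.
by apply: (IH (fun y => 'D_(delta_mx 0 j) f y)); [exact: CkW | exact: Bdf].
Qed.

End CkCalculus.

(** The mean value theorem along the segment from the centre, which stays in
    the ball. *)
Lemma derive0_ball_constant (R : realType) (V : normedModType R)
    (F : V -> R) (x : V) (e : R) :
  (forall y, ball x e y -> differentiable F y) ->
  (forall y v, ball x e y -> 'D_v F y = 0) ->
  forall y, ball x e y -> F y = F x.
Proof.
move=> dF F0 y xy; pose w := y - x; pose l (t : R) := t *: w + x.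
have l_ball (t : R) : t \in `[0, 1]%R -> ball x e (l t).
  rewrite in_itv /= => /andP[t0 t1].
  move: xy; rewrite -ball_normE /= => /(le_lt_trans _); apply.
  rewrite /l opprD addrCA subrr addr0 normrN normrZ ger0_norm// distrC.
  by rewrite ler_piMl.
have dl (t : R) : differentiable l t.
  apply: differentiableD; last exact: differentiable_cst.
  exact: differentiableZl.
have dFl (t : R) : t \in `[0, 1]%R -> is_derive t 1 (F \o l) 0.
  move=> t01; have dFt := dF _ (l_ball _ t01).
  have dc := differentiable_comp (dl t) dFt.
  split; first exact: diff_derivable.
  rewrite (deriveE _ dc) (diff_comp (dl t) dFt) /= -(deriveE _ dFt).
  exact/F0/l_ball.
have dFlo (t : R) : t \in `]0, 1[%R -> is_derive t 1 (F \o l) 0.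
  by move=> t01; apply: dFl; exact: subset_itv_oo_cc.
have cFl : {within `[0, 1], continuous (F \o l)}.
  by apply: derivable_within_continuous => t /dFl [].
have [t _] := MVT_segment ler01 dFlo cFl.
rewrite mul0r /= /l scale1r scale0r add0r subrK => /eqP.
by rewrite subr_eq0 => /eqP.
Qed.

(** * Charts, coordinate fields and functions with zero differential *)

Section Charts.
Variables (R : realType) (d : nat) (M : smoothManifold R d).
Implicit Types (c : chart R d M) (p : M).
(* The bare name also denotes coordinates in a basis of a vector space. *)
Local Notation coord := Defs.coord.

Lemma paramK c (x : 'rV[R]_d) : (coord c @` dom c) x ->
  dom c (param c x) /\ coord c (param c x) = x.
Proof. by move=> [p cp <-]; rewrite coordK. Qed.

Lemma coord_continuous_at c p : dom c p -> {for p, continuous (coord c)}.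
Proof.
move=> cp; have := @Defs.coord_continuous _ _ _ c.
by rewrite (continuous_open_subspace _ (@dom_open _ _ _ c)); apply; rewrite inE.
Qed.

Lemma param_continuous_at c p : dom c p ->
  {for coord c p, continuous (param c)}.
Proof.
move=> cp; have := @param_continuous _ _ _ c.
rewrite (continuous_open_subspace _ (@img_open _ _ _ c)); apply.
by rewrite inE; exists p.
Qed.

Lemma near_param c p (U : set M) : dom c p -> nbhs p U ->
  \forall x \near coord c p, U (param c x).
Proof.
move=> cp; rewrite -{1}(coordK cp); exact: param_continuous_at.
Qed.

Lemma near_dom c p : dom c p -> nbhs p (dom c).
Proof. by move=> cp; apply: open_nbhs_nbhs; split => //; exact: dom_open. Qed.

Lemma open_coord_image c (U : set M) :
  open U -> open (coord c @` (U `&` dom c)).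
Proof.
move=> oU; rewrite openE => _ [p [Up cp] <-].
have nU : nbhs p (U `&` dom c).
  by apply: filterI; [exact: open_nbhs_nbhs | exact: near_dom].
have near_img : nbhs (coord c p) (coord c @` dom c).
  by apply: open_nbhs_nbhs; split; [exact: img_open | exists p].
apply: filterS2 near_img (near_param cp nU) => x /paramK [_ xK] Ux.
by exists (param c x).
Qed.

Lemma transition_differentiable c c' p : atlas c -> atlas c' ->
  dom c p -> dom c' p -> differentiable (coord c' \o param c) (coord c p).
Proof.
move=> ac ac' cp c'p; have [dT _] := transition_smooth ac ac' 1%N.
by apply: dT; exists p.
Qed.

(** Derivatives of a function on [M] read in two charts differ by the
    derivative of the transition map.  With [f] a coordinate map, this says that
    the components of tangent vectors transform consistently. *)
Lemma derive_chart_change (W : normedModType R) c c' p (f : M -> W)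
    (v : 'rV[R]_d) : atlas c -> atlas c' -> dom c p -> dom c' p ->
  differentiable (f \o param c') (coord c' p) ->
  'D_v (f \o param c) (coord c p) =
  'D_('D_v (coord c' \o param c) (coord c p)) (f \o param c') (coord c' p).
Proof.
move=> ac ac' cp c'p df.
have dT := transition_differentiable ac ac' cp c'p.
pose h := (f \o param c') \o (coord c' \o param c).
have fh : \forall x \near coord c p, (f \o param c) x = h x.
  apply: filterS (near_param cp (near_dom c'p)) => x c'x.
  by rewrite /h /= coordK.
have Tp : (coord c' \o param c) (coord c p) = coord c' p by rewrite /= coordK.
rewrite (near_eq_derive _ fh) -Tp.
have df' : differentiable (f \o param c') ((coord c' \o param c) (coord c p)).
  by rewrite Tp.
rewrite (deriveE _ (differentiable_comp dT df')) (diff_comp dT df') /=.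
by rewrite -(deriveE _ dT) -(deriveE _ df').
Qed.

(** The coordinate field of [c] in the direction [v], carried to the preferred
    chart of each point, in which tangent vectors are expressed. *)
Definition const_field c (v : 'rV[R]_d) : vfield M := fun q =>
  'D_v (coord (chart_at q) \o param c) (coord c q).

Lemma const_field_chart_at p (v : tangent p) :
  const_field (chart_at p) v p = v.
Proof.
have cp := chart_at_dom p; rewrite /const_field.
have near_id : \forall x \near coord (chart_at p) p,
    (coord (chart_at p) \o param (chart_at p)) x = id x.
  have : nbhs (coord (chart_at p) p) (coord (chart_at p) @` dom (chart_at p)).
    by apply: open_nbhs_nbhs; split; [exact: img_open | exists p].
  by apply: filterS => x /paramK [].
by rewrite (near_eq_derive _ near_id) derive_id.
Qed.

(** Read in a chart [c'], the field at [x] is the [v]-derivative of the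
    transition map from [c] to [c'], taken at the image of [x] under the
    transition map from [c'] to [c]. *)
Lemma const_field_smooth c (v : 'rV[R]_d) : atlas c ->
  smooth_vfield (dom c) (const_field c v).
Proof.
move=> ac c' ac' k.
have oA : open (coord c' @` (dom c `&` dom c')).
  by apply: open_coord_image; exact: dom_open.
have TS := transition_smooth ac' ac; have ST := transition_smooth ac ac'.
pose F := ('D_v (coord c' \o param c)) \o (coord c \o param c').
apply: (Ck_ext (f := F) oA).
  move=> _ [p [cp c'p] <-].
  rewrite /F /local_rep /comp /const_field /= (coordK c'p).
  have [cp' ap'] := (chart_at_dom p, chart_at_atlas p).
  by apply: derive_chart_change => //; exact: transition_differentiable.
apply: (Ck_comp (B := coord c @` (dom c `&` dom c'))) => //.
- by move=> _ [p [cp c'p] <-]; exists p => //=; rewrite coordK.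
- by rewrite setIC; exact: TS.
- by have [_] := ST k.+1; apply.
Qed.

Lemma smooth_fun_differentiable (f : M -> R) c p :
  smooth_fun [set: M] f -> atlas c -> dom c p ->
  differentiable (f \o param c) (coord c p).
Proof.
by move=> sf ac cp; have [df _] := sf c ac 1%N; apply: df; exists p.
Qed.

Lemma smooth_vfield_sub (U V : set M) (X : vfield M) :
  U `<=` V -> smooth_vfield V X -> smooth_vfield U X.
Proof.
move=> UV sX c ac k; apply: Ck_sub (sX c ac k).
by apply: image_subset; exact: setSI.
Qed.

Lemma differential0_locally_constant (f : M -> R) :
  smooth_fun [set: M] f -> (forall p (v : tangent p), differential f p v = 0) ->
  forall p, \forall q \near p, f q = f p.
Proof.
move=> sf f0 p; pose c := chart_at p.
have [cp ac] : dom c p /\ atlas c := conj (chart_at_dom p) (chart_at_atlas p).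
have : nbhs (coord c p) (coord c @` dom c).
  by apply: open_nbhs_nbhs; split; [exact: img_open | exists p].
move=> /nbhs_ballP [e /= e0 eimg].
have near_p : \forall q \near p, ball (coord c p) e (coord c q).
  by apply: (coord_continuous_at cp); exact: nbhsx_ballx.
apply: filterS2 near_p (near_dom cp) => q bq cq.
rewrite -(coordK cq) -(coordK cp).
apply: (derive0_ball_constant (F := f \o param c) (e := e)) bq.
  move=> y /eimg [r cr <-]; exact: smooth_fun_differentiable.
move=> y v /eimg [r cr <-].
have [c'r ac'] := (chart_at_dom r, chart_at_atlas r).
rewrite (derive_chart_change _ ac ac')//; first exact: f0.
exact: smooth_fun_differentiable.
Qed.

(** A locally constant function has clopen fibres. *)
Lemma differential0_constant (f : M -> R) :
  smooth_fun [set: M] f -> (forall p (v : tangent p), differential f p v = 0) ->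
  exists k, forall p, f p = k.
Proof.
move=> sf f0; have loc := differential0_locally_constant sf f0.
have [[p0 _]|noM] := pselect (exists p : M, True); last first.
  by exists 0 => p; case: noM; exists p.
exists (f p0); pose S := [set q | f q = f p0].
have oS : open S.
  rewrite openE => q Sq; apply: filterS (loc q) => r fr.
  by rewrite /S /= fr.
have cS : closed S.
  rewrite -openC openE => q nSq; apply: filterS (loc q) => r fr.
  by rewrite /S /= fr.
suff ST : S = [set: M] by move=> p; rewrite -[_ = _]/(S p) ST.
apply: (@manifold_connected _ _ M).
- by exists p0.
- by exists S => //; rewrite setTI.
- by exists S => //; rewrite setTI.
Qed.

End Charts.

(** * Orthonormal frames *)

Section InnerProduct.
Variables (R : realType) (d : nat) (B : 'rV[R]_d -> 'rV[R]_d -> R).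
Hypothesis B_linear : forall (a : R) (u v w : 'rV[R]_d),
  B (a *: u + v) w = a * B u w + B v w.
Hypothesis B_sym : forall u v, B u v = B v u.
Hypothesis B_pos : forall u, u != 0 -> 0 < B u u.

(** The conditions are [k] linear equations in [d > k] unknowns: the matrix of
    the [B (delta_mx 0 r) (E j)] has a nonzero left kernel. *)
Lemma exists_orthogonal k (E : nat -> 'rV[R]_d) : (k < d)%N ->
  exists2 w, w != 0 & forall j, (j < k)%N -> B w (E j) = 0.
Proof.
move=> kd; pose Bl (v w : 'rV[R]_d) : R := B w v.
have Bl_lin v : linear (Bl v : 'rV[R]_d -> R) by move=> a u w; exact: B_linear.
pose A := \matrix_(r < d, j < k) B (delta_mx 0 r) (E j).
have : kermx A != 0.
  rewrite kermx_eq0 -row_leq_rank -ltnNge.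
  exact: leq_ltn_trans (rank_leq_col A) kd.
case/rowV0Pn => w /sub_kermxP wA w0; exists w => // j jk.
have LM := GRing.isLinear.Build _ _ _ _ _ (Bl_lin (E j)).
pose L : {linear 'rV[R]_d -> R} := HB.pack (Bl (E j)) LM.
rewrite -[LHS]/(L w) (row_sum_delta w) linear_sum.
have := congr1 (fun N : 'rV[R]_k => N 0 (Ordinal jk)) wA; rewrite !mxE => wA0.
rewrite -[RHS]wA0; apply: eq_bigr => r _.
by rewrite linearZ !mxE.
Qed.

(** Gram-Schmidt, started at a prescribed unit vector so that the frame can
    begin with [xi].  The frame is indexed by [nat], only the first [d] vectors
    being meaningful, which lets it grow without changing type. *)
Lemma exists_orthonormal_frame (u : 'rV[R]_d) : B u u = 1 ->
  exists2 E : nat -> 'rV[R]_d, E 0%N = u &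
  forall i j, (i < d)%N -> (j < d)%N -> B (E i) (E j) = (i == j)%:R.
Proof.
move=> Bu.
suff frame k : (k < d)%N -> exists2 E : nat -> 'rV[R]_d, E 0%N = u &
    forall i j, (i <= k)%N -> (j <= k)%N -> B (E i) (E j) = (i == j)%:R.
  have [d0|d0] := posnP d; first by exists (fun=> u) => // i j; rewrite {1}d0.
  have [|E E0 BE] := frame d.-1; first by rewrite prednK.
  by exists E => // i j id jd; apply: BE; rewrite -ltnS prednK.
elim: k => [_|k IH kd].
  by exists (fun=> u) => // i j; rewrite !leqn0 => /eqP-> /eqP->.
have [E E0 BE] := IH (ltnW kd).
have [w w0 wE] := exists_orthogonal E kd.
have BZ a v z : B (a *: v) z = a * B v z.
  have := B_linear 1 0 0 z; rewrite scale1r addr0 mul1r => /eqP.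
  rewrite -subr_eq subrr => /eqP B0.
  by have := B_linear a v 0 z; rewrite addr0 -B0 addr0.
pose e := (Num.sqrt (B w w))^-1 *: w.
have Bee : B e e = 1.
  have B0 := B_pos w0.
  rewrite BZ B_sym BZ mulrA -invfM -expr2 sqr_sqrtr ?ltW// mulVf//.
  by rewrite gt_eqF.
have eE j : (j <= k)%N -> B e (E j) = 0 by move=> jk; rewrite BZ wE// mulr0.
exists (fun i => if i == k.+1 then e else E i) => //.
move=> i j.
rewrite leq_eqVlt ltnS => /orP ik; rewrite leq_eqVlt ltnS => /orP jk.
case: (eqVneq i k.+1) ik => [-> _|ni [//|ik]];
  case: (eqVneq j k.+1) jk => [-> _|nj [//|jk]].
- exact: Bee.
- by rewrite eE// eq_sym (negbTE nj).
- by rewrite B_sym eE// (negbTE ni).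
- exact: BE.
Qed.

End InnerProduct.

(** * Solitons on trans-Sasakian manifolds *)

Lemma additive_fun0 (V W : zmodType) (f : V -> W) :
  (forall u v, f (u + v) = f u + f v) -> f 0 = 0.
Proof. by move=> fD; apply: (addIr (f 0)); rewrite -fD addr0 add0r. Qed.

Lemma act_cst (R : realType) (d : nat) (M : smoothManifold R d) (X : vfield M)
  (k : R) (p : M) : act X (fun=> k) p = 0.
Proof. exact: derive_cst. Qed.

Section TransSasakian.
Variables (R : realType) (d : nat) (M : smoothManifold R d).
Variables (phi : forall p : M, tangent p -> tangent p) (xi : vfield M).
Variables (eta : forall p : M, tangent p -> R) (g : tensor02 M).
Arguments phi : clear implicits.
Arguments eta : clear implicits.
Arguments g : clear implicits.
Hypothesis hM : almost_contact_metric phi xi eta g.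
Variables (nabla : vfield M -> vfield M -> vfield M).
Hypothesis hnabla : levi_civita g nabla.
Variables (alpha beta : M -> R).
Hypothesis hab : alpha_beta_contact phi xi eta g nabla alpha beta.

Let gP := acm_g hM.
Let nablaP := levi_civita_connection hnabla.

Lemma metricC (p : M) (u v : tangent p) : g p u v = g p v u.
Proof. exact: (Defs.metric_sym gP). Qed.

Lemma metricDl (p : M) (u v w : tangent p) : g p (u + v) w = g p u w + g p v w.
Proof. by have := metric_linear gP 1 u v w; rewrite scale1r mul1r. Qed.

Lemma metricZl (p : M) (a : R) (u w : tangent p) : g p (a *: u) w = a * g p u w.
Proof.
have g0 : g p 0 w = 0.
  by apply: (additive_fun0 (f := g p ^~ w)) => u' v; exact: metricDl.
by have := metric_linear gP a u 0 w; rewrite !addr0 g0 addr0.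
Qed.

Lemma metricBl (p : M) (u v w : tangent p) : g p (u - v) w = g p u w - g p v w.
Proof. by rewrite metricDl -scaleN1r metricZl mulN1r. Qed.

Lemma metricBr (p : M) (w u v : tangent p) : g p w (u - v) = g p w u - g p w v.
Proof. by rewrite !(metricC w) metricBl. Qed.

Lemma metric_xir (p : M) (u : tangent p) : g p u (xi p) = eta p u.
Proof. by rewrite metricC (acm_xi_dual hM). Qed.

Lemma phiZ (p : M) (a : R) (u : tangent p) : phi p (a *: u) = a *: phi p u.
Proof.
have phi_lin := (acm_phi hM).1 p.
have phi0 : phi p 0 = 0.
  by apply: additive_fun0 => u' v; rewrite -{1}[u']scale1r phi_lin scale1r.
by have := phi_lin a u 0; rewrite phi0 !addr0.
Qed.

Lemma phiD (p : M) (u v : tangent p) : phi p (u + v) = phi p u + phi p v.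
Proof. by have := (acm_phi hM).1 p 1 u v; rewrite !scale1r. Qed.

Lemma xi_smooth (U : set M) : smooth_vfield U xi.
Proof. exact: smooth_vfield_sub (acm_xi hM). Qed.

(** [phi xi] is the zero field, and additivity applied to [0 + 0 = 0] makes its
    covariant derivative vanish. *)
Lemma nabla_phi_xi U X p : open U -> smooth_vfield U X -> U p ->
  nabla X (fun q => phi q (xi q)) p = 0.
Proof.
move=> oU sX Up.
have sO : smooth_vfield U (fun q => phi q (xi q)).
  exact: (acm_phi hM).2 _ _ oU (xi_smooth U).
have := connection_additive nablaP oU sX sO sO Up.
rewrite (_ : (fun q => phi q (xi q) + phi q (xi q)) = fun q => phi q (xi q)).
  by move=> /eqP; rewrite -subr_eq subrr => /eqP.
by apply: functional_extensionality_dep => q; rewrite (acm_phi_xi hM) addr0.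
Qed.

(** Differentiate g(xi, xi) = 1. *)
Lemma eta_nabla_xi U X p : open U -> smooth_vfield U X -> U p ->
  eta p (nabla X xi p) = 0.
Proof.
move=> oU sX Up.
have := metric_compatible hnabla oU sX (xi_smooth U) (xi_smooth U) Up.
rewrite (_ : on_fields g xi xi = fun=> 1); last first.
  by apply/funext => q; rewrite /on_fields metric_xir (acm_eta_xi hM).
rewrite act_cst (acm_xi_dual hM) metric_xir => /esym/eqP.
by rewrite -mulr2n mulrn_eq0 /= => /eqP.
Qed.

(** The structure equation with [Y = xi] gives [phi (nabla_X xi)], since
    [phi xi = 0]; as [nabla_X xi] is orthogonal to [xi], it is recovered by
    applying [- phi]. *)
Lemma nabla_xi U X p : open U -> smooth_vfield U X -> U p ->
  nabla X xi p =
  alpha p *: (X p - eta p (X p) *: xi p) - beta p *: phi p (X p).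
Proof.
move=> oU sX Up.
have := hab oU sX (xi_smooth U) Up.
rewrite (nabla_phi_xi oU sX Up) !metric_xir (acm_eta_phi hM) (acm_eta_xi hM).
move=> /(congr1 (phi p)).
rewrite -scaleN1r add0r scale0r !scale1r add0r.
rewrite phiZ (acm_phi_sq hM) (eta_nabla_xi oU sX Up) scale0r subr0.
rewrite scaleN1r opprK => ->; rewrite phiD !phiZ -(scaleN1r (phi p (X p))).
rewrite phiZ (acm_phi_sq hM) scaleN1r opprK.
rewrite -[_ - X p]/(_ + - X p) phiD phiZ (acm_phi_xi hM) scaler0 add0r.
by rewrite -(scaleN1r (X p)) phiZ scaleN1r scalerN.
Qed.

(** Metric compatibility and absence of torsion turn the Lie derivative into
    g(nabla_X xi, Y) + g(X, nabla_Y xi); the [phi] terms cancel by skewness. *)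
Lemma half_lie_xi U X Y p : open U -> smooth_vfield U X -> smooth_vfield U Y ->
  U p -> half_lie xi g X Y p =
  alpha p * (g p (X p) (Y p) - eta p (X p) * eta p (Y p)).
Proof.
move=> oU sX sY Up; have sxi := xi_smooth U.
rewrite /half_lie /lie_tensor02 (metric_compatible hnabla oU sxi sX sY Up).
rewrite -(torsion_free hnabla oU sxi sX Up) -(torsion_free hnabla oU sxi sY Up).
rewrite !(nabla_xi oU _ Up)// !metricBl !metricBr.
rewrite ![g p (X p) (_ *: _)](metricC) !metricZl metricBl metricBl !metricZl.
rewrite !(acm_xi_dual hM) (acm_skew hM) (metricC _ (phi p (Y p))).
rewrite (metricC (Y p) (X p)).
by field.
Qed.

(** [f] is Ric(xi, xi), and the two correction terms in (nabla_X Ric)(xi, xi)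
    are multiples of [eta (nabla_X xi) = 0]. *)
Lemma parallel_ricci_eigenvalue (Ric : tensor02 M) (f : M -> R) :
  parallel02 nabla Ric ->
  (forall p (w : tangent p), Ric p w (xi p) = f p * eta p w) ->
  (forall p (w : tangent p), Ric p (xi p) w = f p * eta p w) ->
  forall p (v : tangent p), differential f p v = 0.
Proof.
move=> hpar RicL RicR p v; pose c := chart_at p; pose X := const_field c v.
have oc : open (dom c) by exact: dom_open.
have cp : dom c p by exact: chart_at_dom.
have sX : smooth_vfield (dom c) X.
  by apply: const_field_smooth; exact: chart_at_atlas.
have sxi := xi_smooth (dom c).
have := hpar _ _ _ _ oc sX sxi sxi _ cp.
rewrite RicL RicR (eta_nabla_xi oc sX cp) mulr0 !subr0 => <-.
rewrite (_ : on_fields Ric xi xi = f).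
  by rewrite /act /X const_field_chart_at.
by apply/funext => q; rewrite /on_fields RicL (acm_eta_xi hM) mulr1.
Qed.

(** The Lie derivative term of the soliton equation vanishes when one argument
    is [xi]. *)
Lemma ricci_soliton_ricci_xi (Ric : tensor02 M) (lambda : M -> R) :
  almost_ricci_soliton g Ric xi lambda ->
  forall p (w : tangent p),
    Ric p w (xi p) = lambda p * eta p w /\ Ric p (xi p) w = lambda p * eta p w.
Proof.
move=> sol p w; pose c := chart_at p; pose X := const_field c w.
have oc : open (dom c) by exact: dom_open.
have cp : dom c p by exact: chart_at_dom.
have sX : smooth_vfield (dom c) X.
  by apply: const_field_smooth; exact: chart_at_atlas.
have sxi := xi_smooth (dom c).
have := sol _ _ _ oc sX sxi _ cp; have := sol _ _ _ oc sxi sX _ cp.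
rewrite !(half_lie_xi oc)// metric_xir (acm_xi_dual hM) (acm_eta_xi hM).
rewrite mulr1 mul1r subrr mulr0 !add0r /X const_field_chart_at.
by split.
Qed.

(** Contraction of the soliton equation in an orthonormal frame starting with
    [xi].  For i > 0, the i-th term is (lambda - alpha) eta(w), the [alpha]
    coming from half the Lie derivative of the metric on (E_i, E_i). *)
Lemma riemann_soliton_ricci_xi n (Ric : tensor02 M) (lambda : M -> R) :
  d = (2 * n + 1)%N -> ricci_tensor g nabla Ric ->
  almost_riemann_soliton g nabla xi lambda ->
  forall p (w : tangent p),
    Ric p w (xi p) = (2 * n)%:R * (lambda p - alpha p) * eta p w /\
    Ric p (xi p) w = (2 * n)%:R * (lambda p - alpha p) * eta p w.
Proof.
move=> dE hRic sol p w; pose c := chart_at p.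
have oc : open (dom c) by exact: dom_open.
have cp : dom c p by exact: chart_at_dom.
have sC v : smooth_vfield (dom c) (const_field c v).
  by apply: const_field_smooth; exact: chart_at_atlas.
have CE (v : tangent p) : const_field c v p = v by exact: const_field_chart_at.
have sxi := xi_smooth (dom c).
have gxi : g p (xi p) (xi p) = 1 by rewrite metric_xir (acm_eta_xi hM).
have [e e0 ge] := exists_orthonormal_frame (@metric_linear _ _ _ _ gP p)
  (@metricC p) (@metric_pos _ _ _ _ gP p) gxi.
have d_gt0 : (0 < d)%N by rewrite dE addn1.
pose E (i : 'I_d) := const_field c (e i).
have gE i j : g p (E i p) (E j p) = (i == j)%:R by rewrite /E !CE ge.
have half := half_lie_xi oc _ _ cp.
have riem i X Y : smooth_vfield (dom c) X -> smooth_vfield (dom c) Y ->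
    X = xi \/ Y = xi ->
    riemann g nabla (E i) X Y (E i) p =
    (i != 0%N :> nat)%:R * ((lambda p - alpha p) * g p (X p) (Y p)).
  move=> sX sY XYxi.
  (* The two identities that use that one of the two arguments is [xi]: here
     for the metric itself, and below for its products with [e i]. *)
  have gXY : g p (X p) (Y p) = eta p (X p) * eta p (Y p).
    by case: XYxi => ->; rewrite ?metric_xir ?(acm_xi_dual hM) (acm_eta_xi hM)
      ?mul1r ?mulr1.
  have := sol _ _ _ _ _ oc (sC (e i)) sX sY (sC (e i)) _ cp.
  have [sE ePP] := (sC (e i), ge i i (ltn_ord i) (ltn_ord i)).
  rewrite /kulkarni_nomizu (half _ _ sE sE) (half _ _ sX sY) (half _ _ sE sY).
  rewrite (half _ _ sX sE) /on_fields !CE (metricC (X p) (e i)) ePP eqxx gXY.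
  move=> /(canRL (addKr _)); rewrite /E => ->.
  have [i0|i0] := eqVneq (i : nat) 0%N.
    by rewrite i0 e0 !(acm_xi_dual hM) (acm_eta_xi hM) /=; ring.
  have eta_e : eta p (e i) = 0.
    by rewrite -(acm_xi_dual hM) -e0 ge// eq_sym (negbTE i0).
  have g_e : g p (e i) (Y p) * g p (e i) (X p) = 0.
    by case: XYxi => ->; rewrite metric_xir eta_e ?mul0r ?mulr0.
  by rewrite eta_e /=; field: g_e.
have sumE (a : R) : \sum_(i < d) (i != 0%N :> nat)%:R * a = (2 * n)%:R * a.
  rewrite -mulr_suml dE addn1 big_ord_recl /= add0r.
  by rewrite sumr_const card_ord.
have RicE (X Y : vfield M) :
    smooth_vfield (dom c) X -> smooth_vfield (dom c) Y ->
    X = xi \/ Y = xi ->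
    Ric p (X p) (Y p) = (2 * n)%:R * ((lambda p - alpha p) * g p (X p) (Y p)).
  move=> sX sY XYxi.
  rewrite (hRic _ _ _ _ _ oc cp (fun i => sC (e i)) gE sX sY) -sumE.
  by apply: eq_bigr => i _; exact: riem.
have := RicE _ _ (sC w) sxi (or_intror erefl).
have := RicE _ _ sxi (sC w) (or_introl erefl).
by rewrite CE metric_xir (acm_xi_dual hM) !mulrA => -> ->.
Qed.

End TransSasakian.

Theorem proposition3p6 (R : realType) (n : nat) (hn : (1 <= n)%N)
    (M : smoothManifold R (2 * n + 1))
    (phi : forall p : M, tangent p -> tangent p) (xi : forall p : M, tangent p)
    (eta : forall p : M, tangent p -> R)
    (g : forall p : M, tangent p -> tangent p -> R)
    (hM : almost_contact_metric phi xi eta g)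
    (nabla : vfield M -> vfield M -> vfield M) (hnabla : levi_civita g nabla)
    (alpha beta : M -> R)
    (halpha : smooth_fun [set: M] alpha) (hbeta : smooth_fun [set: M] beta)
    (hab : alpha_beta_contact phi xi eta g nabla alpha beta)
    (Ric : forall p : M, tangent p -> tangent p -> R)
    (hRic : ricci_tensor g nabla Ric) (hpar : parallel02 nabla Ric)
    (lambda : M -> R) (hlambda : smooth_fun [set: M] lambda) :
  (almost_riemann_soliton g nabla xi lambda ->
     forall (p : M) (v : tangent p),
       differential lambda p v = differential alpha p v) /\
  (almost_ricci_soliton g Ric xi lambda ->
     exists k : R, forall p : M, lambda p = k).
Proof.
split=> sol.
  have ric := riemann_soliton_ricci_xi hM hnabla hab erefl hRic sol.
  move=> p v; pose F q := (2 * n)%:R * (lambda q - alpha q).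
  have F0 : differential F p v = 0.
    apply: (parallel_ricci_eigenvalue hM hnabla hpar) => q w.
      by have [] := ric q w.
    by have [] := ric q w.
  have [ac cp] := (chart_at_atlas p, chart_at_dom p).
  have dl := smooth_fun_differentiable hlambda ac cp.
  have da := smooth_fun_differentiable halpha ac cp.
  have dF : differential F p v =
      (2 * n)%:R * (differential lambda p v - differential alpha p v).
    have dlv := @diff_derivable _ _ _ _ _ v dl.
    have dav := @diff_derivable _ _ _ _ _ v da.
    rewrite /differential -(deriveB dlv dav).
    exact: (deriveZ (2 * n)%:R (derivableB dlv dav)).
  have n2 : (2 * n)%:R != 0 :> R by rewrite pnatr_eq0 muln_eq0 -lt0n hn.
  move: F0; rewrite dF => /eqP; rewrite mulf_eq0 (negbTE n2) /= subr_eq0.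
  by move=> /eqP.
have ric := ricci_soliton_ricci_xi hM hnabla hab sol.
apply: differential0_constant => // p v.
apply: (parallel_ricci_eigenvalue hM hnabla hpar) => q w.
  by have [] := ric q w.
by have [] := ric q w.
Qed.
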